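(* Let $L$ be an oriented starred link or linkoid diagram in a surface and let $\overline{L}$ be the starred diagram obtained from $L$ by reversing the orientation on each of its components, without changing the placement of the stars of $L$. Then $$\nabla_{\overline{L}}(W)=\nabla_L(-W^{-1}).$$
   Context: Surfaces are closed, connected and oriented. A linkoid diagram in a surface is a generic immersion of finitely many unit intervals (long components) and circles, with finitely many transverse double points, each carrying over/under information (crossings); endpoints of long components are distinct from each other and from the crossings; all components are oriented. A link diagram is the case with only circles. The universe is the graph obtained by turning each crossing into a 4-valent vertex and each endpoint into a 1-valent vertex; regions are the connected components of its complement. Diagrams are assumed tightly embedded (every region is a disk); every diagram in $S^2$ is counted as tightly embedded. A starred diagram is a diagram together with stars placed either on some of its regions or on some of its crossings (possibly no stars) so that the number of unstarred regions equals the number of unstarred crossings. Labels. At each crossing there are four local regions (corners): the out-corner (between the two outgoing edges), the in-corner (between the two incoming edges) and two side corners. At a positive crossing the out-corner has label $W$, the in-corner $-W^{-1}$, and both side corners $1$. At a negative crossing the out-corner has label $W^{-1}$, the in-corner $-W$, and both side corners $1$. A state of a starred diagram assigns to every unstarred region one marker, placed at a corner of that region at an unstarred crossing, so that every unstarred crossing receives exactly one marker (if a region occupies several corners at one crossing, different corners give different states). The weight of a state is the product of the labels of the marked corners. The mock Alexander polynomial $\nabla_L(W)$ is the sum of the weights of all states of $L$. *)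

(* Defs.v *)
From HB Require Import structures.
From mathcomp Require Import all_boot all_order all_algebra.

Set Implicit Arguments.
Unset Strict Implicit.
Unset Printing Implicit Defensive.

Import GRing.Theory.
Local Open Scope ring_scope.

(* A diagram in a surface is encoded by the rotation system of its universe.  *)
(* Darts (half-edges) are named by the vertex they leave from: four at each   *)
(* crossing x, (x, 0), ..., (x, 3) in counterclockwise order (indices mod 4), *)
(* with 0, 2 on the under-strand and 1, 3 on the over-strand; one at each     *)
(* endpoint.                                                                  *)
Definition dart (X P : finType) : finType := ((X * 'I_4) + P)%type.

Definition turn_cw (X P : finType) (d : dart X P) : dart X P :=
  match d with
  | inl (x, i) => inl (x, i - 1)
  | inr p => inr p
  end.

(* If d runs along an edge with a region on its left, then the same region is *)
(* on the left of [next_dart mate d], the next edge of that boundary walk.    *)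
Definition next_dart (X P : finType) (mate : dart X P -> dart X P)
  (d : dart X P) : dart X P := turn_cw (mate d).

(* Number of boundary components of the region r.                             *)
Definition nb_boundary (X P C F : finType) (mate : dart X P -> dart X P)
    (left_region : dart X P -> F) (circle_region : C -> bool -> F) (r : F) :
    nat :=
  (fcard (next_dart mate) [pred d | left_region d == r]
     + #|[set cb : C * bool | circle_region cb.1 cb.2 == r]|)%N.

(* Euler characteristic of the surface obtained by glueing, along the         *)
(* universe, one sphere with [nb_boundary r] holes for each region r;         *)
(* crossingless circles contribute 0.                                         *)
Definition euler (X P C F : finType) (mate : dart X P -> dart X P)
    (left_region : dart X P -> F) (circle_region : C -> bool -> F) : int :=
  #|X|%:Z + #|P|%:Z - (#|dart X P|./2)%:Z
    + \sum_(r : F) (2 - (nb_boundary mate left_region circle_region r)%:Z).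

(* The two regions lie on both sides of some edge or crossingless circle.     *)
Definition adjacent (X P C F : finType) (mate : dart X P -> dart X P)
    (left_region : dart X P -> F) (circle_region : C -> bool -> F) : rel F :=
  [rel r s | [exists d, (left_region d == r) && (left_region (mate d) == s)]
          || [exists c, [exists b, (circle_region c b == r)
                                && (circle_region c (~~ b) == s)]]].

(* Unoriented link and linkoid diagrams (links: no endpoint). Components with *)
(* at least one crossing or endpoint are recovered from [mate]; those with    *)
(* neither are listed in [circle], the boolean naming the two sides of such a *)
(* circle. In a diagram all of whose regions are disks, [region] is in        *)
(* bijection with the boundary walks; several boundary walks may belong to    *)
(* one region only in the sphere, where split diagrams are allowed.           *)
Record diagram := Diagram {
  crossing : finType;
  endpoint : finType;
  circle : finType;
  region : finType;
  mate : dart crossing endpoint -> dart crossing endpoint;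
  mateK : involutive mate;
  mate_neq : forall d, mate d != d;
  left_region : dart crossing endpoint -> region;
  left_region_next : forall d, left_region (next_dart mate d) = left_region d;
  circle_region : circle -> bool -> region;
  region_nonempty : (0 < #|region|)%N;
  surface_connected :
    forall r s, connect (adjacent mate left_region circle_region) r s;
  tightly_embedded :
    (forall r, nb_boundary mate left_region circle_region r = 1%N)
    \/ euler mate left_region circle_region = 2
}.

(* [outgoing d]: the orientation points along d away from the vertex of d.    *)
(* [circle_left c] names the side of c lying to the left of c.                *)
Record orientation (D : diagram) := Orientation {
  outgoing : dart (crossing D) (endpoint D) -> bool;
  outgoing_mate : forall d, outgoing (mate d) = ~~ outgoing d;
  outgoing_opposite :
    forall x i, outgoing (inl (x, i + 2)) = ~~ outgoing (inl (x, i));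
  circle_left : circle D -> bool
}.

Record starring (D : diagram) := Starring {
  starred_regions : {set region D};
  starred_crossings : {set crossing D};
  star_kind : starred_regions = set0 \/ starred_crossings = set0;
  star_balance : #|~: starred_regions| = #|~: starred_crossings|
}.

Record starred_diagram := StarredDiagram {
  underlying : diagram;
  orient : orientation underlying;
  stars : starring underlying
}.

Definition reverse_orientation (D : diagram) (o : orientation D) :
    orientation D :=
  {| outgoing := fun d => ~~ outgoing o d;
     outgoing_mate := fun d => congr1 negb (outgoing_mate o d);
     outgoing_opposite := fun x i => congr1 negb (outgoing_opposite o x i);
     circle_left := fun c => ~~ circle_left o c |}.

Definition reverse (L : starred_diagram) : starred_diagram :=
  StarredDiagram (reverse_orientation (orient L)) (stars L).

(* Laurent polynomials in W are regarded inside the field of rational         *)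
(* functions.                                                                 *)
Definition ratfun : fieldType := {fraction {poly int}}.

Definition W : ratfun := tofrac ('X : {poly int}).

(* f(u), for f = n / d; meaningful when d does not vanish at u, in particular *)
(* whenever u is not constant.                                                *)
Definition subst (f : ratfun) (u : ratfun) : ratfun :=
  (map_poly intr \n_(repr f)).[u] / (map_poly intr \d_(repr f)).[u].

Section MockAlexander.

Variable L : starred_diagram.

Local Notation D := (underlying L).

(* The corner (x, i) lies between the darts (x, i) and (x, i + 1).            *)
Definition corner : finType := (crossing D * 'I_4)%type.

(* Left of a dart is its counterclockwise side.                               *)
Definition corner_region (k : corner) : region D := left_region (inl k).

Definition leaves (x : crossing D) (i : 'I_4) : bool :=
  outgoing (orient L) (inl (x, i)).

Definition out_corner (k : corner) : bool :=
  leaves k.1 k.2 && leaves k.1 (k.2 + 1).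

Definition in_corner (k : corner) : bool :=
  ~~ leaves k.1 k.2 && ~~ leaves k.1 (k.2 + 1).

(* A quarter turn counterclockwise takes the direction of the over-strand to  *)
(* that of the under-strand.                                                  *)
Definition positive (x : crossing D) : bool :=
  [exists i : 'I_4, odd i && out_corner (x, i)].

Definition label (k : corner) : ratfun :=
  if out_corner k then (if positive k.1 then W else W^-1)
  else if in_corner k then (if positive k.1 then - W^-1 else - W)
  else 1.

Definition unstarred_region : finType :=
  {r : region D | r \notin starred_regions (stars L)}.

Definition is_state (m : {ffun unstarred_region -> corner}) : bool :=
  [&& [forall r, corner_region (m r) == val r],
      [forall r, (m r).1 \notin starred_crossings (stars L)]
    & [forall x, (x \notin starred_crossings (stars L)) ==>
         (#|[set r | (m r).1 == x]| == 1%N)]].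

Definition weight (m : {ffun unstarred_region -> corner}) : ratfun :=
  \prod_r label (m r).

Definition nabla : ratfun := \sum_(m | is_state m) weight m.

End MockAlexander.

(* Main.v *)
Require Import Defs.
From mathcomp Require Import all_boot all_order all_algebra.

Import GRing.Theory.
Local Open Scope ring_scope.

(** Reversal exchanges the in-corner and the out-corner at each crossing and
keeps the crossing sign. As [W |-> - W^-1] exchanges [W] with [- W^-1] and
[W^-1] with [- W], it turns each label into the label after reversal. States
do not depend on the orientation, so it remains to see that substituting
[- W^-1], which is transcendental over the integers, is a ring morphism on
rational functions. *)

(** [subst] reads off the representative [repr f]; this ties it back to [f]. Equality in the
    fraction field is cross-multiplication of representatives. *)
Lemma fraction_numden (R : idomainType) (f : {fraction R}) :
  f = tofrac (\n_(repr f)) / tofrac (\d_(repr f)).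
Proof.
set x := repr f; have d_neq0 := denom_ratioP x.
apply: (canRL (mulfK _)); first by rewrite tofrac_eq0.
have -> : f = (\pi x)%qT by rewrite reprK.
unlock tofrac; rewrite -[LHS]FracField.pi_mul; apply/eqP.
rewrite FracField.equivf_def /FracField.mulf !numden_Ratio ?mulf_neq0 ?oner_neq0 //.
by rewrite !mulr1 mulrC.
Qed.

Section Substitution.

Variable u : ratfun.

Local Notation ev p := (map_poly intr p).[u].

Hypothesis u_transcendental : forall p : {poly int}, p != 0 -> ev p != 0.

(** Two fractions representing the same element have equal cross products, and evaluation at [u]
    preserves these products; by transcendence neither denominator vanishes at [u]. Hence [subst]
    can be computed on any representative. *)
Lemma subst_frac (n d : {poly int}) :
  d != 0 -> subst (tofrac n / tofrac d) u = ev n / ev d.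
Proof.
move=> d_neq0; rewrite /subst.
set f := tofrac n / tofrac d; have fE := fraction_numden _ f.
have df_neq0 := denom_ratioP (repr f).
apply/eqP; rewrite eqr_div ?u_transcendental //.
rewrite -!hornerM -!rmorphM /=; apply/eqP; congr (ev _).
apply/eqP; rewrite -tofrac_eq !tofracM -eqr_div ?tofrac_eq0 //.
by rewrite -fE.
Qed.

Lemma subst_tofrac (p : {poly int}) : subst (tofrac p) u = ev p.
Proof.
rewrite -[tofrac p]divr1 -(tofrac1 {poly int}) subst_frac ?oner_neq0 //.
by rewrite rmorph1 hornerC divr1.
Qed.

Lemma subst0 : subst 0 u = 0.
Proof. by rewrite -(tofrac0 {poly int}) subst_tofrac rmorph0 horner0. Qed.

Lemma subst1 : subst 1 u = 1.
Proof. by rewrite -(tofrac1 {poly int}) subst_tofrac rmorph1 hornerC. Qed.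

Lemma substD : {morph subst^~ u : f g / f + g}.
Proof.
move=> f g; rewrite (fraction_numden _ f) (fraction_numden _ g).
set a := \n_(repr f); set b := \d_(repr f).
set c := \n_(repr g); set d := \d_(repr g).
have b_neq0 : b != 0 := denom_ratioP (repr f).
have d_neq0 : d != 0 := denom_ratioP (repr g).
rewrite addf_div ?tofrac_eq0 // -!tofracM -tofracD !subst_frac ?mulf_neq0 //.
by rewrite addf_div ?u_transcendental // rmorphD !rmorphM /= hornerD !hornerM.
Qed.

Lemma substM : {morph subst^~ u : f g / f * g}.
Proof.
move=> f g; rewrite (fraction_numden _ f) (fraction_numden _ g).
set a := \n_(repr f); set b := \d_(repr f).
set c := \n_(repr g); set d := \d_(repr g).
have b_neq0 : b != 0 := denom_ratioP (repr f).
have d_neq0 : d != 0 := denom_ratioP (repr g).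
rewrite mulf_div -!tofracM !subst_frac ?mulf_neq0 //.
by rewrite mulf_div !rmorphM /= !hornerM.
Qed.

Lemma substN : {morph subst^~ u : f / - f}.
Proof. by move=> f; apply/eqP; rewrite -addr_eq0 -substD addNr subst0. Qed.

Lemma substV : {morph subst^~ u : f / f^-1}.
Proof.
(* At 0 the convention that the inverse of 0 is 0 applies on both sides. *)
move=> f; have [->|f_neq0] := eqVneq f 0; first by rewrite invr0 subst0 invr0.
have ffV : subst f u * subst f^-1 u = 1 by rewrite -substM divff ?subst1.
have sf_neq0 : subst f u != 0.
  by apply: contra_eq_neq ffV => ->; rewrite mul0r eq_sym oner_neq0.
by apply: (mulfI sf_neq0); rewrite ffV divff.
Qed.

Lemma substW : subst W u = u.
Proof. by rewrite /W subst_tofrac map_polyX hornerX. Qed.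

End Substitution.

Lemma W_neq0 : W != 0.
Proof. by rewrite /W tofrac_eq0 polyX_eq0. Qed.

Lemma oppWV_transcendental (p : {poly int}) :
  p != 0 -> (map_poly intr p).[- W^-1] != 0.
Proof.
move=> p_neq0; set n := (size p).-1.
have size_p : size p = n.+1 by rewrite prednK // lt0n size_poly_eq0.
(* [W^n p(- W^-1)] is a polynomial in [W] whose constant term is, up to sign, *)
(* the leading coefficient of [p].                                            *)
pose q : {poly int} := \sum_(i < n.+1) ((-1) ^+ i * p`_i) *: 'X^(n - i).
have qE : tofrac q = W ^+ n * (map_poly intr p).[- W^-1].
  rewrite (@horner_coef_wide _ n.+1); last by rewrite -size_p size_poly.
  rewrite mulr_sumr rmorph_sum /=; apply: eq_bigr => i _.
  rewrite coef_map /= -mul_polyC tofracM tofracXn -/W.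
  have -> : W ^+ n = W ^+ (n - i) * W ^+ i by rewrite -exprD subnK -1?ltnS.
  (* The coefficient is an integer, and ring morphisms fix the image of the integers. *)
  have -> : tofrac ((-1) ^+ i * p`_i)%:P = (-1) ^+ i * (p`_i)%:~R :> ratfun.
    by rewrite -[_ * p`_i]intz !rmorph_int rmorphM rmorphXn rmorphN1.
  have Wi_neq0 : W ^+ i != 0 by rewrite expf_neq0 ?W_neq0.
  rewrite [(- W^-1) ^+ i]exprNn exprVn.
  rewrite -[RHS]mulrA [_%:~R * _]mulrCA mulrA [RHS]mulrC -!mulrA; congr (_ * _).
  by rewrite [W ^- i * _]mulrCA mulVf ?mulr1.
(* At 0 only the term [i = n] survives, since [n - i] is positive for the others. *)
have : q.[0] != 0.
  rewrite horner_sum big_ord_recr /= big1 => [|i _].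
    rewrite add0r subnn hornerZ hornerXn mulr1 mulf_neq0 ?signr_eq0 //.
    by rewrite -[p`_n]/(lead_coef p) lead_coef_eq0.
  by rewrite hornerZ hornerXn expr0n subn_eq0 leqNgt ltn_ord mulr0.
apply: contra_neq => ev0; have /eqP : tofrac q = 0 by rewrite qE ev0 mulr0.
by rewrite tofrac_eq0 => /eqP ->; rewrite horner0.
Qed.

Section Reversal.

Variable L : starred_diagram.

Lemma leaves_opposite (x : crossing (underlying L)) (i : 'I_4) :
  @leaves L x (i + 2) = ~~ @leaves L x i.
Proof. exact: outgoing_opposite. Qed.

Lemma out_corner_reverse (k : corner L) :
  @out_corner (reverse L) k = @in_corner L k.
Proof. by []. Qed.

Lemma in_corner_reverse (k : corner L) :
  @in_corner (reverse L) k = @out_corner L k.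
Proof. by rewrite /in_corner /leaves /= !negbK. Qed.

(** A half turn about the crossing sends each dart to the other dart of its strand, where the
    direction is opposite. *)
Lemma out_corner_opposite (x : crossing (underlying L)) (i : 'I_4) :
  @out_corner L (x, i + 2) = @in_corner L (x, i).
Proof. by rewrite /out_corner /= addrAC !leaves_opposite. Qed.

Lemma positive_reverse (x : crossing (underlying L)) :
  @positive (reverse L) x = @positive L x.
Proof.
have odd_opposite (i : 'I_4) : odd (i + 2 : 'I_4)%R = odd i.
  by case: i => [[|[|[|[|]]]]].
have opposite_involutive : involutive (fun i : 'I_4 => i + 2).
  by move=> i; rewrite -addrA -[RHS]addr0; congr (_ + _); apply/val_inj.
(* In both directions the witness is the opposite corner: the old in-corner becomes the out-corner,
   and its index has the same parity. *)
apply/existsP/existsP => -[i /andP[odd_i corner_i]]; exists (i + 2).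
  by rewrite odd_opposite odd_i out_corner_opposite.
rewrite odd_opposite odd_i out_corner_reverse -out_corner_opposite.
by rewrite opposite_involutive.
Qed.

Lemma label_reverse (k : corner L) :
  @label (reverse L) k = subst (@label L k) (- W^-1).
Proof.
have tr := oppWV_transcendental.
rewrite /label positive_reverse out_corner_reverse in_corner_reverse.
have [out_k|_] := boolP (@out_corner L k).
  (* [label] tests for the out-corner first, and after reversal that test is the old [in_corner]. *)
  have -> : @in_corner L k = false.
    by case/andP: out_k => leaves_k _; rewrite /in_corner leaves_k.
  by case: ifP => _; rewrite ?substV ?substW // invrN invrK.
case: ifP => _; last by rewrite subst1.
by case: ifP => _; rewrite substN // ?substV // substW // ?invrN ?invrK opprK.
Qed.

End Reversal.

Theorem proposition6 (L : starred_diagram) :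
  nabla (reverse L) = subst (nabla L) (- W^-1).
Proof.
have tr := oppWV_transcendental.
rewrite /nabla (big_morph _ (substD _ tr) (subst0 _ tr)).
(* Both sums have the same index set by conversion: [is_state] reads only the underlying diagram and
   the stars. *)
apply: eq_bigr => m _; rewrite /weight (big_morph _ (substM _ tr) (subst1 _ tr)).
by apply: eq_bigr => r _; exact: label_reverse.
Qed.
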